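(* Let $G$ be a non-cyclic finite group. Then the non-cyclic graph $\Gamma_G$ of $G$ is regular if and only if $G$ is isomorphic to one of the following groups: (1) $Q_8\times \mathbb{Z}_n$, where $n$ is an odd integer and $Q_8$ is the quaternion group of order $8$; (2) $P\times \mathbb{Z}_m$, where $P$ is a finite non-cyclic group of prime exponent $p$ and $m>0$ is an integer such that $\gcd(m,p)=1$.
   Context: For a group $G$, $Cyc(G)=\{x\in G : \langle x,y\rangle \text{ is cyclic for all } y\in G\}$. For a finite non-cyclic group $G$, the non-cyclic graph $\Gamma_G$ is the simple graph with vertex set $G\setminus Cyc(G)$ in which two distinct vertices $x,y$ are adjacent if and only if $\langle x,y\rangle$ is not cyclic. A graph is regular if all its vertices have the same degree. $\mathbb{Z}_n$ denotes the cyclic group of order $n$ (so $n$ is positive). *)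

(* Defs.v *)
From HB Require Import structures.
From mathcomp Require Import all_boot all_algebra all_fingroup all_solvable.

Set Implicit Arguments.
Unset Strict Implicit.
Unset Printing Implicit Defensive.

Local Open Scope group_scope.

Record sgraph := SGraph {
  vertex :> finType;
  adj : rel vertex;
  adj_sym : symmetric adj;
  adj_irrefl : irreflexive adj
}.

Definition degree (X : sgraph) (x : X) : nat := #|[set y : X | adj x y]|.

Definition regular_graph (X : sgraph) : Prop :=
  forall x y : X, degree x = degree y.

Section NonCyclicGraph.

Variables (gT : finGroupType) (G : {group gT}).

Definition Cyc : {set gT} :=
  [set x in G | [forall y in G, cyclic <<[set x; y]>>]].

Definition noncyclic_vertex : finType := {x : gT | x \in G :\: Cyc}.

Definition noncyclic_adj (x y : noncyclic_vertex) : bool :=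
  (x != y) && ~~ cyclic <<[set val x; val y]>>.

Lemma noncyclic_adj_sym : symmetric noncyclic_adj.
Proof. by move=> x y; rewrite /noncyclic_adj eq_sym setUC. Qed.

Lemma noncyclic_adj_irrefl : irreflexive noncyclic_adj.
Proof. by move=> x; rewrite /noncyclic_adj eqxx. Qed.

Definition noncyclic_graph : sgraph :=
  SGraph noncyclic_adj_sym noncyclic_adj_irrefl.

End NonCyclicGraph.

(* Main.v *)
Require Import Defs.
From mathcomp Require Import all_boot all_algebra all_fingroup all_solvable.

Set Implicit Arguments.
Unset Strict Implicit.
Unset Printing Implicit Defensive.

Local Open Scope group_scope.

(* Write [M x] for the set of the [y] in [G] such that [<x, y>] is cyclic: the
   degree of [x] is [|G| - |M x|], so regularity says that [|M x|] is constant
   off [C := Cyc G].  Since [x \in <[w]>] gives [M w \subset M x], constancy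
   forces the [M x] to be the maximal cyclic subgroups, all of the same order and
   meeting pairwise in the central cyclic subgroup [C]; they partition [G / C].
   If two primes [p < q] divided [|M x / C|], then a [q]-element normalising a
   [p]-part of some [M x] would centralise it, whence the Sylow [q]-subgroups
   would be the [q]-parts of the [M x] and the [M x] would all be conjugate: [G]
   would be the union of the conjugates of a proper subgroup.  So there is only one
   such [p], [G] is the product of a [p]-group [P] and of the [p']-part of [C],
   and [x ^+ p \in C] for all [x \in P].  Either [p] does not divide [|C|] and
   [P] has exponent [p], or [P] has a unique subgroup of order [p], is generalised
   quaternion, and comparing orders leaves only [Q_8]. *)

(** * Automorphisms of cyclic [p]-groups and unions of conjugates *)

(** If [<[z]>] has order [p ^ k] with [k > 0], its automorphism group has order [p ^ k.-1 * p.-1],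
    prime to [q > p]; so the [q]-element [y] acts trivially on it. *)
Lemma pgroup_norm_cycle_commute (gT : finGroupType) (p q : nat) (z y : gT) :
  prime p -> prime q -> p < q -> p.-elt z -> q.-elt y -> y \in 'N(<[z]>) ->
  commute z y.
Proof.
move=> p_pr q_pr ltpq pz qy nzy.
have nYZ : <[y]> \subset 'N(<[z]>) by rewrite cycle_subG.
have q'A : q^'.-group (Aut <[z]>).
  rewrite /pgroup card_Aut_cycle p'natE //.
  have [[|k] ->] := p_natP pz; first by rewrite gtnNdvd ?prime_gt1.
  rewrite totient_pfactor // Euclid_dvdM // negb_or Euclid_dvdX // negb_and.
  rewrite (dvdn_prime2 q_pr p_pr) gtn_eqF //= andbT gtnNdvd //.
    by rewrite -ltnS prednK ?prime_gt0 ?prime_gt1.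
  by rewrite (leq_ltn_trans (leq_pred p)).
have: y \in 'ker (conj_aut <[z]>).
  apply/kerP => //.
  have im_sub := Aut_conj_aut <[z]> <[y]>.
  have q_im : q.-group (conj_aut <[z]> @* <[y]>) by apply: morphim_pgroup.
  have t1 : conj_aut <[z]> @* <[y]> = 1.
    by apply: card1_trivg; apply: (pnat_1 q_im); apply: pgroupS q'A.
  have: conj_aut <[z]> y \in conj_aut <[z]> @* <[y]>.
    by apply: mem_morphim; rewrite ?cycle_id.
  by rewrite t1 => /set1P.
by rewrite ker_conj_aut cent_cycle => /cent1P.
Qed.

(** Counting argument: [H] normalises [H^#], so there are at most [#|G : H|] conjugates of [H^#],
    covering at most [#|G| - #|G : H|] elements, fewer than [#|G^#|]. *)
Lemma class_support_proper (gT : finGroupType) (G H : {group gT}) :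
  H \proper G -> ~~ (G \subset class_support H G).
Proof.
move=> /properP[sHG [g0 Gg0 nHg0]]; apply/negP => sG.
have ltI : 1 < #|G : H|.
  by rewrite ltn_neqAle indexg_gt0 andbT eq_sym indexg_eq1; apply: contra nHg0 => /subsetP->.
have le1 : #|G^#| <= #|cover (H^# :^: G)|.
  by rewrite subset_leq_card // -class_supportD1 setSD.
have le2 : #|cover (H^# :^: G)| <= #|G : H| * #|H^#|.
  apply: leq_trans (leq_card_cover _) _.
  rewrite (eq_bigr (fun=> #|H^#|)); last by move=> A /imsetP[x _ ->]; rewrite cardJg.
  rewrite sum_nat_const leq_mul2r card_conjugates.
  apply/orP; right; apply: dvdn_leq; first exact: indexg_gt0.
  apply: indexgS; rewrite subsetI sHG /=.
  by rewrite normD1 normG.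
have := leq_trans le1 le2.
rewrite !cardsDS ?sub1G ?cards1 // mulnBr muln1 mulnC Lagrange //.
have: #|G : H| <= #|G| by rewrite -(Lagrange sHG) leq_pmull.
move: (cardG_gt0 G) ltI; case: #|G| => // n _; case: #|G : H| => // k k_gt0.
rewrite !subSS subn0 ltnS => le_kn.
have k0 : 0 < k by [].
by rewrite leqNgt ltn_subrL k0 (leq_trans k0).
Qed.

(** * Cyclicizers and vertex degrees *)

Definition cyclicizer (gT : finGroupType) (G : {set gT}) (x : gT) : {set gT} :=
  [set y in G | cyclic <<[set x; y]>>].

Section Cyclicizer.

Variables (gT : finGroupType) (G : {group gT}).
Implicit Types x y z w : gT.

Notation C := (Cyc G).
Notation M := (cyclicizer G).

Lemma cyclic2_mem x y z t :
  cyclic <<[set x; y]>> -> z \in <<[set x; y]>> -> t \in <<[set x; y]>> ->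
  cyclic <<[set z; t]>>.
Proof.
move=> cyc zxy txy; apply: cyclicS cyc.
by rewrite gen_subG subUset !sub1set zxy.
Qed.

Lemma cyclic_cycle2 x y z : y \in <[x]> -> z \in <[x]> -> cyclic <<[set y; z]>>.
Proof.
move=> xy xz; apply: cyclicS (cycle_cyclic x).
by rewrite gen_subG subUset !sub1set xy.
Qed.

Lemma cyclic2P x y :
  reflect (exists2 z, z \in <<[set x; y]>> & x \in <[z]> /\ y \in <[z]>)
          (cyclic <<[set x; y]>>).
Proof.
apply: (iffP cyclicP) => [[z def_z] | [z zxy [xz yz]]]; exists z.
- by rewrite def_z cycle_id.
- by split; rewrite -def_z mem_gen // !inE eqxx ?orbT.
apply/eqP; rewrite eqEsubset gen_subG subUset !sub1set xz yz /=.
by rewrite cycle_subG.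
Qed.

Lemma gen2_subG x y : x \in G -> y \in G -> <<[set x; y]>> \subset G.
Proof. by move=> Gx Gy; rewrite gen_subG subUset !sub1set Gx. Qed.

(** Trades cyclicity for a common root [z]. The conjunct [x \in G] can sit on the boolean side
    because a root in [G] forces it. *)
Lemma cyclicizerP x y :
  reflect (y \in G /\ exists2 z, z \in G & x \in <[z]> /\ y \in <[z]>)
          ((x \in G) && (y \in M x)).
Proof.
rewrite inE; apply: (iffP and3P) => [[Gx Gy /cyclic2P[z zxy xyz]]|].
  by split=> //; exists z => //; apply: (subsetP (gen2_subG Gx Gy)).
case=> Gy [z Gz [xz yz]]; split=> //; last exact: cyclic_cycle2 yz.
by apply: subsetP xz; rewrite cycle_subG.
Qed.

Lemma cyclicizer_id x : x \in G -> x \in M x.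
Proof. by move=> Gx; rewrite inE Gx setUid cycle_cyclic. Qed.

Lemma cyclicizerC x y : x \in G -> y \in M x -> x \in M y.
Proof. by move=> Gx; rewrite !inE setUC Gx => /andP[]. Qed.

Lemma sub_cyclicizer x : M x \subset G.
Proof. by apply/subsetP => y /[1!inE] /andP[]. Qed.

Lemma cyclicizerS x y : y \in <[x]> -> M x \subset M y.
Proof.
move=> yx; apply/subsetP => z; rewrite !inE => /andP[-> /=] cyc.
apply: cyclic2_mem cyc _ _; last by rewrite mem_gen // !inE eqxx orbT.
by apply: subsetP yx; rewrite cycle_subG mem_gen // !inE eqxx.
Qed.

Lemma CycP x : reflect (x \in G /\ G \subset M x) (x \in C).
Proof.
rewrite inE; apply: (iffP andP) => -[Gx].
  by move=> /'forall_implyP h; split=> //; apply/subsetP => y Gy; rewrite inE Gy h.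
move=> /subsetP h; split=> //; apply/'forall_implyP => y /h.
by rewrite inE => /andP[].
Qed.

Lemma Cyc_sub : C \subset G.
Proof. by apply/subsetP => x /CycP[]. Qed.

Lemma Cyc_cycle x y : x \in C -> y \in <[x]> -> y \in C.
Proof.
move=> /CycP[Gx sGM] yx; apply/CycP; split.
  by apply: subsetP yx; rewrite cycle_subG.
exact: subset_trans sGM (cyclicizerS yx).
Qed.

Lemma Cyc_group_set : group_set C.
Proof.
apply/group_setP; split=> [|x y].
  apply/CycP; split=> //; apply/subsetP => y Gy; rewrite inE Gy.
  exact: cyclic_cycle2 (group1 _) (cycle_id y).
move=> /CycP[Gx /subsetP sGx] /CycP[Gy /subsetP sGy]; apply/CycP; split; first exact: groupM.
apply/subsetP => t Gt; rewrite inE Gt /=.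
(* Put [y] and [t] in one cycle [<[s]>], then [x] and [s] in one cycle [<[r]>], which contains both
   [x * y] and [t]. *)
have /cyclicizerP[_ [s Gs [ys ts]]] : (y \in G) && (t \in M y) by rewrite Gy sGy.
have /cyclicizerP[_ [r Gr [xr sr]]] : (x \in G) && (s \in M x) by rewrite Gx sGx.
have ssr : <[s]> \subset <[r]> by rewrite cycle_subG.
by apply: (@cyclic_cycle2 r); rewrite ?groupM // (subsetP ssr).
Qed.

Canonical Cyc_group := Group Cyc_group_set.

Lemma Cyc_cyclicizer x : x \in G -> C \subset M x.
Proof.
by move=> Gx; apply/subsetP => y /CycP[Gy /subsetP/(_ x Gx)/(cyclicizerC Gy)].
Qed.

Lemma cyclicizer_commute x y : y \in M x -> commute x y.
Proof.
rewrite inE => /andP[_ /cyclic_abelian/centsP cab].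
by apply: cab; rewrite mem_gen // !inE eqxx ?orbT.
Qed.

Lemma Cyc_cent : C \subset 'C(G).
Proof.
apply/centsP => x /CycP[_ /subsetP sGM] y /sGM; exact: cyclicizer_commute.
Qed.

(** The neighbours of [v] are exactly the elements of [G] outside [M (val v)]: that set already
    contains [val v] and all of [C], so neither the missing vertices nor the absence of loops
    changes the count. *)
Lemma degree_noncyclic (v : noncyclic_graph G) :
  degree v = #|G| - #|M (val v)|.
Proof.
rewrite -cardsDS ?sub_cyclicizer // /degree -(card_imset _ val_inj).
apply: eq_card => y; apply/imsetP/setDP => [[u]|[Gy nMy]].
  rewrite !inE => /andP[_ ncyc] ->; have /setDP[Gu _] := valP u.
  by rewrite Gu (negPf ncyc).
have Gv : val v \in G by have /setDP[] := valP v.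
have nCy : y \in G :\: C.
  rewrite inE Gy andbT; apply: contra nMy => Cy.
  exact: subsetP (Cyc_cyclicizer Gv) _ Cy.
exists (exist (fun x => x \in G :\: C) y nCy) => //.
rewrite inE /= /noncyclic_adj /=; apply/andP; split; last first.
  by apply: contra nMy => cyc; rewrite inE Gy.
by apply: contra nMy => /eqP vy; rewrite vy cyclicizer_id.
Qed.

Lemma regular_noncyclicP :
  regular_graph (noncyclic_graph G) <->
  {in G :\: C &, forall x y, #|M x| = #|M y|}.
Proof.
have leM x : #|M x| <= #|G| by rewrite subset_leq_card ?sub_cyclicizer.
split=> [reg x y Vx Vy | eqM u v].
  have := reg (exist _ x Vx) (exist _ y Vy).
  rewrite !degree_noncyclic /= => /eqP; rewrite eqn_sub2lE ?leM // => /eqP //.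
by rewrite !degree_noncyclic (eqM (val u) (val v)) // (valP u, valP v).
Qed.

End Cyclicizer.

(** * Cyclicizers under regularity *)

Section Regular.

Variables (gT : finGroupType) (G : {group gT}).
Implicit Types x y z w : gT.

Notation C := (Cyc_group G).
Notation M := (cyclicizer G).

Hypothesis ncG : ~~ cyclic G.
Hypothesis regM : {in G :\: C &, forall x y, #|M x| = #|M y|}.

(** For a common root [z] of [x] and [y], [M z] lies in both [M x] and [M y]; equal cardinals turn
    the inclusions into equalities. *)
Lemma cyclicizer_eq x y : x \in G :\: C -> y \in M x -> y \notin C -> M y = M x.
Proof.
move=> Vx Mxy nCy; have /setDP[Gx nCx] := Vx.
have /cyclicizerP[Gy [z Gz [xz yz]]] : (x \in G) && (y \in M x) by rewrite Gx.
have Vy : y \in G :\: C by rewrite inE nCy.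
have Vz : z \in G :\: C.
  by rewrite inE Gz andbT; apply: contra nCx => /Cyc_cycle; apply.
have eqMz t : t \in G :\: C -> t \in <[z]> -> M z = M t.
  move=> Vt tz; apply/eqP; rewrite eqEcard (cyclicizerS _ tz).
  by rewrite (regM Vt Vz) leqnn.
by rewrite -(eqMz x) // -(eqMz y).
Qed.

(** Take [w] of maximal order among the roots of [x]: a common root of [w] and any element of [M w]
    generates no more than [<[w]>]. *)
Lemma cyclicizer_cycle x : x \in G :\: C ->
  exists2 w, w \in G :\: C & M x = <[w]> /\ M w = <[w]>.
Proof.
move=> Vx; have /setDP[Gx nCx] := Vx.
have Px : (x \in G) && (x \in <[x]>) by rewrite Gx cycle_id.
have [w /andP[Gw xw] maxw] := @arg_maxnP _ x
  [pred w | (w \in G) && (x \in <[w]>)] (fun w => #[w]) Px.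
have Vw : w \in G :\: C.
  by rewrite inE Gw andbT; apply: contra nCx => /Cyc_cycle; apply.
have Mw : M w = <[w]>.
  apply/eqP; rewrite eqEsubset; apply/andP; split; apply/subsetP => z.
    move=> Mwz.
    have /cyclicizerP[Gz [v Gv [wv zv]]] : (w \in G) && (z \in M w) by rewrite Gw.
    have swv : <[w]> \subset <[v]> by rewrite cycle_subG.
    suff -> : <[w]> = <[v]> by [].
    apply/eqP; rewrite eqEcard swv; apply: maxw.
    by rewrite /= Gv (subsetP swv).
  move=> zw; rewrite inE (cyclic_cycle2 (cycle_id w) zw) andbT.
  by apply: subsetP zw; rewrite cycle_subG.
by exists w => //; split=> //; rewrite -Mw; apply: cyclicizer_eq; rewrite ?Mw.
Qed.

(** Outside [C], [x] and [C] lie in one cyclic group, where orders decide inclusion. Membership in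
    [C] thus transfers between elements of equal order. *)
Lemma mem_CycE x : x \in G -> (x \in C) = (#[x] %| #|C|).
Proof.
move=> Gx; apply/idP/idP=> [Cx | ]; first exact: order_dvdG.
apply: contraLR => nCx; have Vx : x \in G :\: C by rewrite inE nCx.
have [w Vw [Mx Mw]] := cyclicizer_cycle Vx.
have sxw : <[x]> \subset <[w]> by rewrite cycle_subG /= -Mx cyclicizer_id.
have sCw : C \subset <[w]> by rewrite -Mx Cyc_cyclicizer.
by rewrite orderE (cardSg_cyclic (cycle_cyclic w)) // cycle_subG.
Qed.

(* Modulo [C] the elements [x] and [y] commute, so that the [n]-th power of
   [x * y] is that of [y]; this puts [x * y] in the class of [y]. *)
Lemma expg_mem_Cyc x y n :
  x \in G :\: C -> y \in G :\: C -> [~ y, x] \in C -> y \notin M x ->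
  x ^+ n \in C -> y ^+ n \in C.
Proof.
move=> Vx Vy Cyx nMxy Cxn; apply: contraR nMxy => nCyn.
have [/setDP[Gx nCx] /setDP[Gy nCy]] := (Vx, Vy).
have cC z t : z \in C -> t \in G -> commute t z.
  by move=> Cz Gt; apply/commute_sym/(centsP (Cyc_cent G)).
have Exy : (x * y) ^+ n = x ^+ n * y ^+ n * [~ y, x] ^+ 'C(n, 2).
  by apply: expMg_Rmul; apply: cC.
have [w Vw [My Mw]] := cyclicizer_cycle Vy.
have sCy : C \subset <[w]> by rewrite -My Cyc_cyclicizer.
have yw : y \in <[w]> by rewrite -My cyclicizer_id.
have Gxy : x * y \in G by rewrite groupM.
have nCxyn : (x * y) ^+ n \notin C.
  by rewrite Exy groupMr ?groupX // groupMl.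
have Vxy : x * y \in G :\: C.
  by rewrite inE Gxy andbT; apply: contra nCxyn; apply: groupX.
have Mxyn : (x * y) ^+ n \in M y.
  rewrite My Exy groupM ?(subsetP sCy _ (groupX _ Cyx)) //.
  by rewrite groupM ?(subsetP sCy _ Cxn) ?groupX.
have : x * y \in M y.
  rewrite -(cyclicizer_eq Vy Mxyn nCxyn) (cyclicizer_eq Vxy) ?cyclicizer_id //.
  by rewrite inE groupX // (cyclic_cycle2 (cycle_id _) (mem_cycle _ _)).
by rewrite My groupMr //= -My => /(cyclicizerC Gy).
Qed.

(** * Excluding two primes modulo [C] *)

Lemma coprime_expg_mem_Cyc y n : coprime #[y] n -> y ^+ n \in C -> y \in C.
Proof.
move=> co_yn Cyn; apply: Cyc_cycle Cyn _.
by have /eqP <- : generator <[y]> (y ^+ n); rewrite ?cycle_id ?generator_coprime.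
Qed.

Lemma mem_cycle_constt w pi y :
  y \in <[w]> -> pi.-elt y -> y \in <[w.`_pi]>.
Proof.
move=> wy piy; rewrite -cycle_subG -(cardSg_cyclic (cycle_cyclic w)).
- by rewrite -!orderE order_constt -(part_pnat_id piy) partn_dvd // order_dvdG.
- by rewrite cycle_subG.
by rewrite cycle_subG mem_cycle.
Qed.

Lemma cyclicizer_constt w pi : w \in G :\: C -> M w = <[w]> ->
  w.`_pi \notin C -> M w.`_pi = <[w]>.
Proof. by move=> Vw Mw nC; rewrite -Mw; apply: cyclicizer_eq; rewrite // Mw mem_cycle. Qed.

(** The element [g] normalises, hence centralises, the cycle of the [p]-part [z] of [w]. If [g] were
    outside [M z], then [g ^+ #[g] = 1] would give [z ^+ #[g] \in C], and [z \in C] by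
    coprimality. *)
Lemma normalising_elt_in_cyclicizer p q w g :
    prime p -> prime q -> p < q -> w \in G :\: C -> M w = <[w]> ->
    w.`_p \notin C -> g \in G -> q.-elt g -> w.`_p ^ g \in <[w]> ->
  g \in <[w]>.
Proof.
move=> p_pr q_pr ltpq Vw Mw nCz Gg qg wzg; set z := w.`_p in nCz wzg *.
have pz : p.-elt z by apply: p_elt_constt.
have /setDP[Gw _] := Vw.
have Gz : z \in G by rewrite groupX.
apply: contraR (nCz) => nwg.
have czg : commute z g.
  apply: (pgroup_norm_cycle_commute p_pr q_pr) => //.
  by rewrite inE -cycleJ cycle_subG mem_cycle_constt // /p_elt orderJ.
have Vz : z \in G :\: C by rewrite inE nCz.
have Mz : M z = <[w]> by apply: cyclicizer_constt.
have Vg : g \in G :\: C.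
  rewrite inE Gg andbT; apply: contra nwg; rewrite -Mw.
  exact/subsetP/Cyc_cyclicizer.
apply: (@coprime_expg_mem_Cyc z #[g]).
  by apply: (@pnat_coprime p) => //; apply: pi_pnat qg _; rewrite !inE gtn_eqF.
apply: (expg_mem_Cyc Vg Vz); last by rewrite expg_order group1.
  by rewrite (eqP (introT commgP czg)) group1.
by apply: contra nwg => /(cyclicizerC Gg); rewrite Mz.
Qed.

Lemma cent_constt_cyclicizer p q w :
    prime p -> prime q -> p < q -> w \in G :\: C -> M w = <[w]> ->
    w.`_p \notin C -> w.`_q \notin C ->
  'C_G[w.`_q] = <[w]>.
Proof.
move=> p_pr q_pr ltpq Vw Mw nCp nCq; have /setDP[Gw _] := Vw.
have sCw : C \subset <[w]> by rewrite -Mw Cyc_cyclicizer.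
set x := w.`_q in nCq *; set n := #[x].
have Gx : x \in G by rewrite groupX.
have Vx : x \in G :\: C by rewrite inE nCq.
have Mx : M x = <[w]> by apply: cyclicizer_constt.
have qn : q.-nat n by apply: p_elt_constt.
(* Elements commuting with [x] outside its class inherit [x ^+ n = 1] modulo [C]; this forces the
   [q']-part of [y] into [C]. *)
have powC t : t \in G -> commute x t -> t \notin <[w]> -> t ^+ n \in C.
  move=> Gt cxt nwt; apply: (expg_mem_Cyc Vx); rewrite ?Mx //.
  - by rewrite inE Gt andbT; apply: contra nwt; apply: subsetP.
  - by rewrite (eqP (introT commgP (commute_sym cxt))) group1.
  by rewrite expg_order group1.
apply/eqP; rewrite eqEsubset; apply/andP; split; last first.
  by rewrite cycle_subG inE Gw; apply/cent1P/commuteX.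
apply/subsetP => y /setIP[Gy /cent1P/commute_sym cxy].
apply: contraT => nwy.
have q'y : y.`_q^' \in C.
  apply: (@coprime_expg_mem_Cyc _ n).
    by rewrite coprime_sym; apply: pnat_coprime qn (p_elt_constt _ _).
  by rewrite -expgM mulnC expgM groupX // powC.
have nwu : y.`_q \notin <[w]>.
  apply: contra nwy => wyq.
  by rewrite -(consttC q y) groupM // (subsetP sCw).
case/negP: nwu; apply: (normalising_elt_in_cyclicizer p_pr q_pr ltpq) => //.
- by rewrite groupX.
- exact: p_elt_constt.
set u := y.`_q; have cxu : commute x u by apply: commuteX.
have Gu : u \in G by rewrite groupX.
apply: contraT => nwzu.
(* The conjugate by [u] of the [p]-part of [w] still commutes with [x]. If it left [<[w]>], [powC]
   and coprimality would put it in the central subgroup [C], and conjugating back would put the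
   [p]-part itself there. *)
have /powC : w.`_p ^ u \in G by rewrite groupJ ?groupX.
have cxzu : commute x (w.`_p ^ u).
  have -> : x = x ^ u by rewrite conjgE cxu mulKg.
  by rewrite /commute -!conjMg; congr (_ ^ _); apply: commuteX2.
move=> /(_ cxzu nwzu) /coprime_expg_mem_Cyc Czu.
case/negP: nCp; rewrite -(conjgK u w.`_p).
have Czu' : w.`_p ^ u \in C.
  apply: Czu; rewrite orderJ; apply: (@pnat_coprime p); first exact: p_elt_constt.
  by apply: pi_pnat qn _; rewrite !inE gtn_eqF.
by rewrite conjgE (centsP (Cyc_cent G) _ Czu') ?groupV // mulgA mulVg mul1g.
Qed.

(** Normalisers grow in a Sylow subgroup [Q] properly containing [<[x]>]. A new [g] normalising
    [<[x]>] also normalises its centraliser [<[w]>], so it lies in [<[w]>] and, as a [q]-element, in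
    [<[x]>]. *)
Lemma Sylow_constt_cyclicizer p q w :
    prime p -> prime q -> p < q -> w \in G :\: C -> M w = <[w]> ->
    w.`_p \notin C -> w.`_q \notin C ->
  q.-Sylow(G) <[w.`_q]>.
Proof.
move=> p_pr q_pr ltpq Vw Mw nCp nCq; have /setDP[Gw _] := Vw.
set x := w.`_q.
have Gx : x \in G by rewrite groupX.
have qx : q.-group <[x]> by apply: p_elt_constt.
have sxG : <[x]> \subset G by rewrite cycle_subG.
have [Q sylQ sxQ] := Sylow_superset sxG qx.
have [sQG qQ _] := and3P sylQ.
have [defQ | neq] := eqVneq <[x]> Q; first by rewrite /= defQ.
have ltxQ : <[x]> \proper Q by rewrite properEneq sxQ andbT.
have := nilpotent_proper_norm (pgroup_nil qQ) ltxQ.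
case/properP=> _ [g /setIP[Qg nxg] nxg'].
have Gg := subsetP sQG g Qg.
have qg : q.-elt g := mem_p_elt qQ Qg.
case/negP: nxg'; apply: mem_cycle_constt => //.
apply: (normalising_elt_in_cyclicizer p_pr q_pr ltpq) => //.
have : w ^ g \in 'C_G[x].
  rewrite inE groupJ //= -cent_cycle -(normP nxg) centJ memJ_conjg.
  by rewrite cent_cycle; apply/cent1P/commuteX.
rewrite (cent_constt_cyclicizer p_pr q_pr ltpq) // => wwg.
by rewrite conjXg groupX.
Qed.

Lemma constt_notin_Cyc_inj p q w :
    prime p -> prime q -> w \in G :\: C -> M w = <[w]> ->
    w.`_p \notin C -> w.`_q \notin C ->
  p = q.
Proof.
move=> p_pr q_pr Vw Mw nCp nCq.
wlog ltpq : p q p_pr q_pr nCp nCq / p < q.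
  by case: (ltngtP p q) => // [ltpq | ltqp] ih; [apply: ih | apply/esym/ih].
have /setDP[Gw _] := Vw.
have pr_w : <[w]> \proper G.
  rewrite properEneq cycle_subG Gw andbT.
  by apply: contra ncG => /eqP <-; apply: cycle_cyclic.
case/negP: (class_support_proper pr_w); apply/subsetP => v Gv.
rewrite class_supportEr; apply/bigcupP.
have [Cv | nCv] := boolP (v \in C).
  exists 1 => //; rewrite conjsg1 /= -Mw.
  exact: subsetP (Cyc_cyclicizer Gw) _ Cv.
have Vv : v \in G :\: C by rewrite inE nCv.
have [w' Vw' [Mv Mw']] := cyclicizer_cycle Vv; have /setDP[Gw' _] := Vw'.
have ow' : #[w'] = #[w] by rewrite !orderE -Mw -Mw'; apply: regM.
(* Since [w] and [w'] have the same order, the hypotheses on the parts of [w] pass to [w']. *)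
have eqC r : (w'.`_r \in C) = (w.`_r \in C).
  by rewrite !mem_CycE ?groupX // !order_constt ow'.
have sylQ := Sylow_constt_cyclicizer p_pr q_pr ltpq Vw Mw nCp nCq.
have sylQ' : q.-Sylow(G) <[w'.`_q]>.
  by apply: (Sylow_constt_cyclicizer p_pr q_pr ltpq); rewrite ?eqC.
have [g Gg /= defQ'] := Sylow_trans sylQ sylQ'.
exists g => //=.
(* The cycles of [w] and [w'] are conjugate, being the centralisers of conjugate Sylow subgroups. *)
rewrite -(cent_constt_cyclicizer p_pr q_pr ltpq Vw Mw nCp nCq).
rewrite conjIg conjGid // -cent_cycle -centJ -defQ' cent_cycle.
by rewrite (cent_constt_cyclicizer p_pr q_pr) ?eqC // -Mv cyclicizer_id.
Qed.

(** * The single prime and the splitting of [G] *)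

(** If [C] were all of [G], an element of maximal order would share a cycle with every other element
    and so generate [G]. *)
Lemma Cyc_proper : C \proper G.
Proof.
rewrite properE Cyc_sub; apply: contra ncG => /subsetP sGC.
have [w Gw maxw] := @arg_maxnP _ 1 [in G] (fun w => #[w]) (group1 G).
suff -> : G :=: <[w]> by apply: cycle_cyclic.
apply/eqP; rewrite eqEsubset cycle_subG Gw andbT; apply/subsetP => z Gz.
have /CycP[_ /subsetP/(_ z Gz)] := sGC w Gw.
rewrite inE => /andP[_ /cyclic2P[v vwz [wv zv]]].
suff -> : <[w]> = <[v]> by [].
apply/eqP; rewrite eqEcard cycle_subG wv; apply: maxw.
by apply: subsetP vwz; apply: gen2_subG.
Qed.

Lemma Cyc_cyclic : cyclic C.
Proof.
have [_ [x Gx nCx]] := properP Cyc_proper.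
have [|w _ [Mx _]] := @cyclicizer_cycle x; first by rewrite inE nCx.
apply: cyclicS (cycle_cyclic w).
by rewrite /= -Mx Cyc_cyclicizer.
Qed.

Lemma order_cyclicizer_gen w w' :
    w \in G :\: C -> M w = <[w]> -> w' \in G :\: C -> M w' = <[w']> ->
  #[w] = #[w'].
Proof. by move=> Vw Mw Vw' Mw'; rewrite !orderE -Mw -Mw'; apply: regM. Qed.

Lemma p'elt_mem_Cyc :
  exists2 p, prime p & forall x, x \in G -> p^'.-elt x -> x \in C.
Proof.
have [_ [x0 Gx0 nCx0]] := properP Cyc_proper.
have [|w Vw [_ Mw]] := @cyclicizer_cycle x0; first by rewrite inE nCx0.
have /setDP[Gw nCw] := Vw.
have [p p_pr nCwp] : exists2 p, prime p & w.`_p \notin C.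
  (* Bounding [p] by [#[w]] makes the search finite; if every primary part of [w] were in [C], the
     order of [w] would divide [#|C|]. *)
  have : ~~ [forall p : 'I_#[w].+1, prime p ==> (w.`_p \in C)].
    apply: contra nCw => /forallP h; rewrite mem_CycE //.
    apply/dvdn_partP => [|p]; first exact: order_gt0.
    rewrite mem_primes => /and3P[p_pr _ p_w].
    have ltp : p < #[w].+1 by rewrite ltnS dvdn_leq.
    have := h (Ordinal ltp); rewrite /= p_pr /=.
    by rewrite mem_CycE ?groupX // order_constt.
  by case/forallPn=> p; rewrite negb_imply => /andP[p_pr ?]; exists p.
exists p => // x Gx p'x.
rewrite mem_CycE //; apply/dvdn_partP => [|q]; first exact: order_gt0.
move=> q_x; have q'p : q != p by have := pnatPpi p'x q_x.
have q_pr : prime q by move: q_x; rewrite mem_primes => /andP[].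
have [Cx | nCx] := boolP (x \in C).
  by apply: dvdn_trans (dvdn_part _ _) _; rewrite -mem_CycE.
have [|v Vv [Mx Mv]] := @cyclicizer_cycle x; first by rewrite inE nCx.
have xv : x \in <[v]> by rewrite -Mx cyclicizer_id.
(* The [q]-part of [#[x]] divides that of [#[v] = #[w]], and the [q]-part of [w] lies in [C] unless
   [q = p]. *)
apply: (@dvdn_trans #[v]`_q); first by rewrite partn_dvd // order_dvdG.
rewrite (order_cyclicizer_gen Vv Mv Vw Mw) -order_constt -mem_CycE; last exact: groupX.
apply: contraR q'p => nCwq.
by rewrite (constt_notin_Cyc_inj p_pr q_pr Vw Mw).
Qed.

(** All [p']-parts are central, so [G / 'Z(G)] is a [p]-group and [G] is nilpotent. *)
Lemma regular_pcore_dprod p : prime p ->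
    (forall x, x \in G -> p^'.-elt x -> x \in C) ->
  'O_p(G) \x 'O_p^'(G) = G.
Proof.
move=> p_pr p'C; apply: nilpotent_pcoreC; rewrite -quotient_center_nil.
apply: (@pgroup_nil _ p); apply/pgroupP => q q_pr /(Cauchy q_pr)[xb].
case/morphimP=> x Nx Gx -> oxb.
have Zx : x.`_p^' \in 'Z(G).
  rewrite inE groupX //=; apply: (subsetP (Cyc_cent G)).
  by apply: p'C; rewrite ?groupX ?p_elt_constt.
have defx : coset 'Z(G) x = coset 'Z(G) x.`_p.
  rewrite -{1}(consttC p x) morphM ?groupX //=.
  by rewrite [X in _ * X]coset_id ?mulg1.
have : p.-elt (coset 'Z(G) x.`_p) by rewrite morph_p_elt ?groupX ?p_elt_constt.
by rewrite -defx /p_elt oxb pnatE.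
Qed.

(** * Structure of the [p]-core *)

Section Prime.

Variable p : nat.
Hypotheses (p_pr : prime p)
  (p'C : forall x, x \in G -> p^'.-elt x -> x \in C).

Notation P := 'O_p(G).
Notation B := 'O_p^'(G).

Lemma p'core_sub_Cyc : B \subset C.
Proof.
apply/subsetP => x Bx; apply: p'C; first exact: subsetP (pcore_sub _ _) x Bx.
exact: mem_p_elt (pcore_pgroup _ _) Bx.
Qed.

Lemma pcore_noncyclic : ~~ cyclic P.
Proof.
apply: contra ncG => cycP.
rewrite (cyclic_dprod (regular_pcore_dprod p_pr p'C)) //.
  exact: pnat_coprime (pcore_pgroup _ _) (pcore_pgroup _ _).
exact: cyclicS p'core_sub_Cyc Cyc_cyclic.
Qed.

Lemma p_elt_mem_pcore x : x \in G -> p.-elt x -> x \in P.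
Proof.
have nilG : nilpotent G.
  have := regular_pcore_dprod p_pr p'C.
  move=> defG; rewrite (dprod_nil defG) (pgroup_nil (pcore_pgroup _ _)).
  by apply: abelian_nil; apply: cyclic_abelian; apply: cyclicS p'core_sub_Cyc Cyc_cyclic.
by move=> Gx px; rewrite (mem_normal_Hall (nilpotent_pcore_Hall p nilG)) ?pcore_normal.
Qed.

(* Take [z] in [P] whose image in [P / C] is central of order [p].  Every [t] in
   [P] outside the class of [z] commutes with [z] modulo [C], so [t ^+ p] is in
   [C]; all classes having the same size, this extends to the class of [z]. *)
Lemma pcore_expg_Cyc x : x \in P -> x ^+ p \in C.
Proof.
have pP : p.-group P := pcore_pgroup _ _.
have sPG : P \subset G := pcore_sub _ _.
have nCG : G \subset 'N(C).
  by apply: subset_trans (cent_sub _); rewrite centsC; apply: Cyc_cent.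
have nCP := subset_trans sPG nCG.
have [z Pz [nCz Czp Rz]] : exists2 z, z \in P &
   [/\ z \notin C, z ^+ p \in C & forall t, t \in P -> [~ t, z] \in C].
  have pPb : p.-group (P / C) by apply: quotient_pgroup.
  have ntPb : P / C != 1.
    rewrite -subG1 quotient_sub1 //; apply: contra pcore_noncyclic => sPC.
    exact: cyclicS sPC Cyc_cyclic.
  have ntZ : 'Z(P / C) != 1 by rewrite center_nil_eq1 ?(pgroup_nil pPb).
  have pZ : p.-group 'Z(P / C) := pgroupS (center_sub _) pPb.
  have [_ pdvd _] := pgroup_pdiv pZ ntZ.
  have [zb /setIP[/morphimP[z Nz Pz ->] /centP cz] ozb] := Cauchy p_pr pdvd.
  exists z => //; split.
  - by apply: contraTN p_pr => Cz; rewrite -ozb /= coset_id ?order1.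
  - by apply: coset_idr; rewrite ?groupX // morphX //= -ozb expg_order.
  move=> t Pt; have Nt := subsetP nCP t Pt.
  apply: coset_idr; rewrite ?groupR // morphR //=.
  by apply/eqP/commgP/commute_sym/cz/mem_quotient.
have Gz := subsetP sPG z Pz.
have Vz : z \in G :\: C by rewrite inE nCz.
have powP t : t \in P -> t \notin M z -> t ^+ p \in C.
  move=> Pt nMt; have Gt := subsetP sPG t Pt.
  apply: (expg_mem_Cyc Vz _ (Rz t Pt)) => //.
  by rewrite inE Gt andbT; apply: contra nMt; apply/subsetP/Cyc_cyclicizer.
have [y Py nMy] : exists2 y, y \in P & y \notin M z.
  apply/subsetPn; apply: contra pcore_noncyclic.
  have [w _ [-> _]] := cyclicizer_cycle Vz => sPw.
  exact: cyclicS sPw (cycle_cyclic w).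
have Gy := subsetP sPG y Py.
have Vy : y \in G :\: C.
  by rewrite inE Gy andbT; apply: contra nMy; apply/subsetP/Cyc_cyclicizer.
have [w Vw [My Mw]] := cyclicizer_cycle Vy; have /setDP[Gw nCw] := Vw.
have nCwp : w.`_p \notin C.
  apply: contra nCw => Cwp; rewrite -(consttC p w) groupM // p'C ?groupX //.
  exact: p_elt_constt.
have Cwpp : w.`_p ^+ p \in C.
  apply: powP; first by rewrite p_elt_mem_pcore ?groupX ?p_elt_constt.
  apply: contra nMy => Mzwp.
  rewrite -(cyclicizer_eq Vz Mzwp) // (cyclicizer_constt Vw Mw) // -My.
  exact: cyclicizer_id.
move=> Px; have [Cx | nCx] := boolP (x \in C); first exact: groupX.
have Gx := subsetP sPG x Px.
have [|v Vv [Mx Mv]] := @cyclicizer_cycle x; first by rewrite inE nCx.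
have /setDP[Gv _] := Vv.
have : x \in <[v.`_p]>.
  by apply: mem_cycle_constt (mem_p_elt pP Px); rewrite -Mx cyclicizer_id.
case/cycleP=> i ->; rewrite -expgM mulnC expgM groupX //.
(* The [p]-parts of [v] and [w] have equal orders, hence so do their [p]-th powers. *)
rewrite mem_CycE ?groupX // orderXgcd order_constt.
rewrite (order_cyclicizer_gen Vv Mv Vw Mw) -order_constt -orderXgcd.
by rewrite -mem_CycE //; do 2!apply: groupX.
Qed.

Lemma pcore_exponent_or_Q8 :
  {in P, forall x, x ^+ p = 1} \/ p = 2 /\ P \isog [set: 'Q_8].
Proof.
have pP : p.-group P := pcore_pgroup _ _.
have sPG : P \subset G := pcore_sub _ _.
have [pC | p'cC] := boolP (p %| #|C|); [right | left]; last first.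
  move=> x Px; apply/eqP; rewrite -order_eq1.
  have : x ^+ p \in C by apply: pcore_expg_Cyc.
  rewrite mem_CycE ?groupX ?(subsetP sPG) // => dvC.
  have p'o : p^'.-nat #[x ^+ p] by apply: pnat_dvd dvC _; rewrite p'natE.
  by apply/eqP/(pnat_1 _ p'o)/(mem_p_elt pP)/groupX.
have ntP : P != 1 by apply: contra pcore_noncyclic => /eqP ->; apply: cyclic1.
(* Elements killed by [p] have order dividing [#|C|], so they lie in the cyclic group [C]; this
   leaves one subgroup of order [p]. *)
have sOC : 'Ohm_1(P) \subset C.
  rewrite (OhmE 1 pP) gen_subG; apply/subsetP => x /LdivP[Px xp].
  rewrite mem_CycE ?(subsetP sPG) //; apply: dvdn_trans pC.
  by rewrite order_dvdn -[p]expn1 xp.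
have cO : #|'Ohm_1(P)| = p.
  rewrite -Ohm_id; apply: Ohm1_cyclic_pgroup_prime.
  - exact: cyclicS sOC Cyc_cyclic.
  - exact: pgroupS (Ohm_sub _ _) pP.
  by rewrite Ohm1_eq1.
have /(prime_Ohm1P pP ntP) := cO.
rewrite (negPf pcore_noncyclic) /= => /andP[/eqP p2 /eqP/quaternion_classP[n n_gt2 isoP]].
split=> //.
have [[x y] genP _] := generators_quaternion n_gt2 isoP.
have [_ _ [_ cZ _ _ _] _ _] := quaternion_structure n_gt2 genP isoP.
have [_ Px ox _] := genP.
(* The generator [x] has order [2 ^ n.-1], while its square is in the centre, of order 2; so
   [2 ^ n.-1] divides 4. *)
have Zx2 : x ^+ 2 \in 'Z(P).
  rewrite inE groupX //=.
  apply: (subsetP (centS sPG)); apply: (subsetP (Cyc_cent G)).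
  by rewrite -{1}p2 pcore_expg_Cyc.
have := order_dvdG Zx2; rewrite cZ order_dvdn -expgM -order_dvdn -[(2 * 2)%N]/(2 ^ 2)%N.
rewrite ox dvdn_Pexp2l // -subn1 leq_subLR => n_le3.
have n3 : n = 3 by apply/eqP; rewrite eqn_leq n_le3.
by rewrite n3 in isoP.
Qed.

End Prime.

End Regular.

(** * Direct products with a coprime cyclic factor *)

Lemma isog_setX_dprod (gT aT bT : finGroupType) (G : {group gT})
    (A : {group aT}) (B : {group bT}) :
  G \isog setX A B ->
  exists A1 B1 : {group gT}, [/\ A1 \x B1 = G, A \isog A1 & B \isog B1].
Proof.
rewrite isog_sym => /isogP[f injf defG].
have sA : setX A 1 \subset setX A B by rewrite setXS ?sub1G.
have sB : setX 1 B \subset setX A B by rewrite setXS ?sub1G.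
exists (f @* setX A 1)%G, (f @* setX 1 B)%G; split.
- by rewrite /= (injm_dprod (subxx _) injf (setX_dprod A B)).
- exact: isog_trans (isog_setX1 _ A) (sub_isog sA injf).
exact: isog_trans (isog_set1X _ B) (sub_isog sB injf).
Qed.

Section DirectProduct.

Variables (gT : finGroupType) (A B G : {group gT}).
Hypotheses (defG : A \x B = G) (cycB : cyclic B) (coAB : coprime #|A| #|B|).

(** By coprimality [a] is a power of [a * b]; conversely, a cyclic [<a, a'>] times the coprime
    cyclic [B] stays cyclic. *)
Lemma cyclic_gen2_dprod a a' b b' :
    a \in A -> a' \in A -> b \in B -> b' \in B ->
  cyclic <<[set a * b; a' * b']>> = cyclic <<[set a; a']>>.
Proof.
have [_ _ cAB _] := dprodP defG.
have mem_cycle_mul u v : u \in A -> v \in B -> u \in <[u * v]>.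
  move=> Au Bv; have cuv : commute u v by apply/commute_sym/(centsP cAB).
  have co_uv : coprime #[u] #[v].
    exact: coprime_dvdl (order_dvdG Au) (coprime_dvdr (order_dvdG Bv) coAB).
  by rewrite cycleM // -{1}[u]mulg1 mem_mulg ?cycle_id.
move=> Aa Aa' Bb Bb'; apply/idP/idP => cyc.
  have sub u v : u \in A -> v \in B -> u * v \in [set a * b; a' * b'] ->
      u \in <<[set a * b; a' * b']>>.
    move=> Au Bv in_uv; apply: subsetP (mem_cycle_mul u v Au Bv).
    by rewrite cycle_subG mem_gen.
  apply: cyclic2_mem cyc _ _.
    by apply: (sub a b); rewrite // !inE eqxx.
  by apply: (sub a' b'); rewrite // !inE eqxx orbT.
have sA : <<[set a; a']>> \subset A by rewrite gen2_subG.
apply: (@cyclicS _ (<<[set a; a']>> <*> B)).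
  have inA u : u \in [set a; a'] -> u \in <<[set a; a']>> <*> B.
    by move=> uaa; apply: (subsetP (joing_subl _ _)); apply: mem_gen.
  have inB v : v \in B -> v \in <<[set a; a']>> <*> B.
    exact/subsetP/joing_subr.
  apply: gen2_subG; apply: groupM; try exact: inB.
    by apply: inA; rewrite !inE eqxx.
  by apply: inA; rewrite !inE eqxx orbT.
apply: cyclicY => //; first exact: subset_trans cAB (centS sA).
exact: coprimeSg sA coAB.
Qed.

Lemma cyclicizer_dprod a b : a \in A -> b \in B ->
  cyclicizer G (a * b) = cyclicizer A a * B.
Proof.
move=> Aa Bb; have [_ defAB _ _] := dprodP defG.
apply/setP => x; rewrite inE -defAB; apply/andP/mulsgP => [[]|].
  case/mulsgP=> u v Au Bv -> cyc; exists u v => //.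
  by rewrite inE Au -(cyclic_gen2_dprod Aa Au Bb Bv).
case=> u v /[1!inE] /andP[Au cyc] Bv ->.
by rewrite mem_mulg // cyclic_gen2_dprod.
Qed.

(** A cyclicizer need not be a subgroup, so the product set is counted through injectivity of
    multiplication, from [A :&: B = 1]. *)
Lemma card_cyclicizer_dprod a b : a \in A -> b \in B ->
  #|cyclicizer G (a * b)| = (#|cyclicizer A a| * #|B|)%N.
Proof.
move=> Aa Bb; have [_ _ _ tiAB] := dprodP defG.
rewrite cyclicizer_dprod // (_ : _ * _ = mulg @2: (cyclicizer A a, B)) //.
rewrite curry_imset2X card_in_imset ?cardsX //.
move=> [u v] [u' v'] /setXP[/= /(subsetP (sub_cyclicizer _ _)) Au Bv].
move=> /setXP[/= /(subsetP (sub_cyclicizer _ _)) Au' Bv'] eq_uv.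
have eqd : u'^-1 * u = v' * v^-1 by rewrite -[u](mulgK v) eq_uv -mulgA mulKg.
have : u'^-1 * u \in A :&: B by rewrite inE {2}eqd !groupM ?groupV.
rewrite tiAB => /set1P u1; have eu : u = u' by rewrite -(mulKVg u' u) u1 mulg1.
by move: eq_uv; rewrite eu => /mulgI ->.
Qed.

Lemma regular_dprod :
    {in A :\: Cyc A &, forall x y, #|cyclicizer A x| = #|cyclicizer A y|} ->
  {in G :\: Cyc G &, forall x y, #|cyclicizer G x| = #|cyclicizer G y|}.
Proof.
move=> regA; have [_ defAB _ _] := dprodP defG.
have factor x : x \in G :\: Cyc G ->
    exists2 a, a \in A :\: Cyc A & #|cyclicizer G x| = (#|cyclicizer A a| * #|B|)%N.
  case/setDP; rewrite -{1}defAB => /mulsgP[a b Aa Bb ->] nCab.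
  exists a; last exact: card_cyclicizer_dprod.
  rewrite inE Aa andbT; apply: contra nCab => /CycP[_ sAM]; apply/CycP.
  by rewrite cyclicizer_dprod // -defAB mem_mulg // mulSg.
by move=> x y /factor[a Va ->] /factor[b Vb ->]; rewrite (regA a b).
Qed.

End DirectProduct.

(** * Regularity of the two families *)

Lemma cyclic_Zp n : cyclic (Zp n).
Proof. by rewrite /Zp; case: ifP; rewrite ?cyclic1 // Zp_cycle cycle_cyclic. Qed.

(** Nontrivial elements all have order [exponent P], so a vertex [x] generates the same cycle as any
    of its roots, and its cyclicizer is [<[x]>]. *)
Lemma regular_exponent_prime (gT : finGroupType) (P : {group gT}) :
    prime (exponent P) ->
  {in P :\: Cyc P &, forall x y, #|cyclicizer P x| = #|cyclicizer P y|}.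
Proof.
move=> p_pr; have card_cyc x : x \in P :\: Cyc P -> #|cyclicizer P x| = exponent P.
  case/setDP=> Px nCx.
  have ord z : z \in P -> z != 1 -> #[z] = exponent P.
    move=> Pz ntz; apply/(prime_nt_dvdP p_pr); first by rewrite order_eq1.
    exact: dvdn_exponent.
  have ntx : x != 1 by apply: contraNneq nCx => ->; apply: (group1 (Cyc_group P)).
  rewrite -(ord x Px ntx); apply: eq_card => y; apply/idP/idP => [Mxy | xy].
    have /cyclicizerP[_ [z Pz [xz yz]]] : (x \in P) && (y \in cyclicizer P x).
      by rewrite Px.
    have ntz : z != 1.
      by apply: contraNneq ntx => z1; move: xz; rewrite z1 cycle1 => /set1P ->.
    have -> // : <[x]> = <[z]>.
    by apply/eqP; rewrite eqEcard cycle_subG xz -!orderE /= (ord x) // (ord z) //.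
  rewrite inE (cyclic_cycle2 (cycle_id x) xy) andbT.
  by apply: subsetP xy; rewrite cycle_subG.
by move=> x y Vx Vy; rewrite !card_cyc.
Qed.

(** The unique involution lies in every nontrivial cycle, hence in [Cyc P]. Vertices therefore have
    order 4, the largest order in [P], and each cyclicizer is a cycle of order 4. *)
Lemma regular_quaternion (gT : finGroupType) (P : {group gT}) :
    P \isog [set: 'Q_8] ->
  {in P :\: Cyc P &, forall x y, #|cyclicizer P x| = #|cyclicizer P y|}.
Proof.
move=> isoP; have isoP' : P \isog [set: 'Q_(2 ^ 3)] by [].
have n_gt2 : 2 < 3 by [].
have [[x0 y0] genP _] := generators_quaternion n_gt2 isoP'.
have [_ _ [_ cZ uniq2 _ _] _ _] := quaternion_structure n_gt2 genP isoP'.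
have oP : #|P| = (2 ^ 3)%N by rewrite (card_isog isoP') card_quaternion.
have ncP : ~~ cyclic P.
  apply/negP => /cyclic_abelian /center_idP Z; by rewrite -Z cZ in oP.
have ord z : z \in P -> #[z] \in [:: 1; 2; 4]%N.
  move=> Pz; have := order_dvdG Pz; rewrite oP => /dvdn_pfactor[//|[|[|[|[|//]]]] _ oz];
  rewrite oz ?inE //.
  case/negP: ncP; apply/cyclicP; exists z; apply/esym/eqP.
  by rewrite eqEcard cycle_subG Pz -orderE oz oP.
have nt2 z b : z \in P -> #[z] = 2 -> b \in P -> b != 1 -> z \in <[b]>.
  move=> Pz oz Pb ntb; have := ord b Pb; rewrite !inE order_eq1 (negPf ntb) /=.
  case/orP=> /eqP ob.
    by rewrite (uniq2 z) // -(uniq2 b) // cycle_id.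
  have ob2 : #[b ^+ 2] = 2 by rewrite orderXdiv ob.
  by rewrite (uniq2 z) // -(uniq2 (b ^+ 2)) ?groupX ?cycle_id.
have card_cyc x : x \in P :\: Cyc P -> #|cyclicizer P x| = 4.
  case/setDP=> Px nCx; have ox : #[x] = 4.
    have := ord x Px; rewrite !inE => /or3P[ox | /eqP ox | /eqP //]; case/negP: nCx.
      rewrite order_eq1 in ox; rewrite (eqP ox); exact: (group1 (Cyc_group P)).
    apply/CycP; split=> //; apply/subsetP => b Pb; rewrite inE Pb /=.
    have [-> | ntb] := eqVneq b 1; first exact: cyclic_cycle2 (cycle_id x) (group1 _).
    exact: cyclic_cycle2 (nt2 x b Px ox Pb ntb) (cycle_id b).
  rewrite -{1}ox; apply: eq_card => y; apply/idP/idP => [Mxy | xy].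
    have /cyclicizerP[_ [z Pz [xz yz]]] : (x \in P) && (y \in cyclicizer P x).
      by rewrite Px.
    have -> // : <[x]> = <[z]>.
    apply/eqP; rewrite eqEcard cycle_subG xz -!orderE ox.
    by have := ord z Pz; rewrite !inE => /or3P[] /eqP ->.
  rewrite inE (cyclic_cycle2 (cycle_id x) xy) andbT.
  by apply: subsetP xy; rewrite cycle_subG.
by move=> x y Vx Vy; rewrite !card_cyc.
Qed.

(* [Zp n] is the cyclic group of order n for every n > 0, including n = 1
   (whereas the full type ['Z_1] has two elements). *)
Theorem theorem5p1 (gT : finGroupType) (G : {group gT}) (ncG : ~~ cyclic G) :
  regular_graph (noncyclic_graph G) <->
  (exists n : nat, odd n /\ G \isog setX [set: 'Q_8] (Zp n))
  \/ (exists (pT : finGroupType) (P : {group pT}) (p m : nat),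
        [/\ ~~ cyclic P, prime p & exponent P = p] /\
        [/\ (0 < m)%N, gcdn m p = 1%N & G \isog setX P (Zp m)]).
Proof.
split=> [/regular_noncyclicP regM | ]; last first.
  case=> [[n [odd_n]] | [pT [P [p [m [[ncP p_pr expP] [m_gt0 co_mp]]]]]]].
    case/isog_setX_dprod=> A [B [defG isoA isoB]].
    apply/regular_noncyclicP/(regular_dprod defG).
    - by rewrite -(isog_cyclic isoB) cyclic_Zp.
    - rewrite -(card_isog isoA) -(card_isog isoB) card_Zp ?odd_gt0 //.
      by rewrite (@card_quaternion 3) // coprimeXl // coprime2n.
    by apply: regular_quaternion; rewrite isog_sym.
  case/isog_setX_dprod=> A [B [defG isoA isoB]].
  have expA : exponent A = p by rewrite -(exponent_isog isoA).
  apply/regular_noncyclicP/(regular_dprod defG).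
  - by rewrite -(isog_cyclic isoB) cyclic_Zp.
  - have pA : p.-group A by rewrite -pnat_exponent expA pnat_id.
    apply: (pnat_coprime pA); rewrite -(card_isog isoB) card_Zp //.
    by rewrite p'natE // -prime_coprime // /coprime gcdnC co_mp.
  by apply: regular_exponent_prime; rewrite expA.
have [p p_pr p'C] := p'elt_mem_Cyc ncG regM.
(* The [p']-core [B] lies in the cyclic group [C], so its order serves as [n] or [m]. *)
set P := 'O_p(G)%G; set B := 'O_p^'(G)%G.
have defG : P \x B = G := regular_pcore_dprod p_pr p'C.
have ncP : ~~ cyclic P by apply: (pcore_noncyclic ncG regM p_pr p'C).
have p'B : p^'.-group B := pcore_pgroup _ _.
have isoB : B \isog Zp #|B|.
  have /cyclicP[b defB] : cyclic B.
    exact: cyclicS (p'core_sub_Cyc p'C) (Cyc_cyclic ncG regM).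
  by rewrite isog_sym defB; apply: Zp_isog.
have isoG (aT : finGroupType) (A : {group aT}) :
    P \isog A -> G \isog setX A (Zp #|B|).
  move=> isoA; apply: isog_dprod defG (setX_dprod A (Zp_group _)) _ _.
    exact: isog_trans isoA (isog_setX1 _ _).
  exact: isog_trans isoB (isog_set1X _ _).
case: (pcore_exponent_or_Q8 ncG regM p_pr p'C) => [expP | [p2 isoQ]].
  right; exists gT, P, p, #|B|; split.
    split=> //; apply/(prime_nt_dvdP p_pr); last exact/exponentP.
    by rewrite -dvdn1 -trivg_exponent; apply: contra ncP => /eqP ->; apply: cyclic1.
  split; [exact: cardG_gt0 | | exact: isoG (isog_refl _)].
  by apply/eqP; rewrite -/(coprime _ _) coprime_sym prime_coprime // -p'natE //; apply: p'B.
left; exists #|B|; split; last exact: isoG isoQ.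
by rewrite -[odd _]negbK -dvdn2 -p2 -p'natE //; apply: p'B.
Qed.
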